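(* Let $F\colon \mathcal{C} \to \mathcal{D}$ be a morphism of categories with denominators. Suppose that $\mathcal{D}$ is multiplicative and that $F$ is S-full and S-faithful. Moreover, suppose given a choice of S-replacements $R = ((X_Y, q_Y))_{Y \in \mathrm{Ob}\,\mathcal{D}}$ for $\mathcal{D}$ along $F$. Then the functors $$\mathsf{GZ}(F)\colon \mathsf{GZ}(\mathcal{C}) \to \mathsf{GZ}(\mathcal{D}), \qquad \hat{\mathrm{Q}}_{\mathrm{S},R} F\colon \mathsf{GZ}(\mathcal{D}) \to \mathsf{GZ}(\mathcal{C})$$ are mutually isomorphism inverse equivalences of categories. An isotransformation $\alpha\colon \hat{\mathrm{Q}}_{\mathrm{S},R} F \circ \mathsf{GZ}(F) \to \mathrm{id}_{\mathsf{GZ}(\mathcal{C})}$ is given by $$\alpha_{X'} = (\bar{\mathrm{Q}}_{\mathrm{S}} F)_{(X_{FX'}, q_{FX'}), (X', 1_{FX'})} 1_{FX'}\colon X_{FX'} \to X'$$ for $X' \in \mathrm{Ob}\,\mathsf{GZ}(\mathcal{C}) = \mathrm{Ob}\,\mathcal{C}$, and an isotransformation $\beta\colon \mathsf{GZ}(F) \circ \hat{\mathrm{Q}}_{\mathrm{S},R} F \to \mathrm{id}_{\mathsf{GZ}(\mathcal{D})}$ is given by $$\beta_Y = \mathrm{loc}(q_Y)\colon F X_Y \to Y$$ for $Y \in \mathrm{Ob}\,\mathsf{GZ}(\mathcal{D}) = \mathrm{Ob}\,\mathcal{D}$, where $\mathrm{loc}\colon \mathcal{D} \to \mathsf{GZ}(\mathcal{D})$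 is the localisation functor.
   Context: Conventions: every category has a set of objects and a set of morphisms (one works with Grothendieck universes). The composite of morphisms $f\colon X \to Y$ and $g\colon Y \to Z$ is written $fg\colon X \to Z$ (diagrammatic order); the composite of functors $F\colon \mathcal{C} \to \mathcal{D}$ and $G\colon \mathcal{D}\to\mathcal{E}$ is written $G \circ F$. Functors $H\colon \mathcal{A} \to \mathcal{B}$ and $K\colon \mathcal{B} \to \mathcal{A}$ are mutually isomorphism inverse equivalences if $K \circ H \cong \mathrm{id}_{\mathcal{A}}$ and $H \circ K \cong \mathrm{id}_{\mathcal{B}}$. An isotransformation is a natural isomorphism. A category with denominators is a category $\mathcal{C}$ together with an arbitrary subset of $\mathrm{Mor}\,\mathcal{C}$, whose elements are called denominators in $\mathcal{C}$. A morphism of categories with denominators $F\colon \mathcal{C} \to \mathcal{D}$ is a functor that maps denominators in $\mathcal{C}$ to denominators in $\mathcal{D}$. A category with denominators is multiplicative if its denominators are closed under composition and contain all identities. $\mathsf{GZ}(\mathcal{C})$ is the Gabriel/Zisman localisation of $\mathcal{C}$ at its denominators, with localisation functor $\mathrm{loc}\colon \mathcal{C} \to \mathsf{GZ}(\mathcal{C})$, which is the identity on objects: $\mathrm{loc}$ maps denominators to isomorphisms, and every functor $H\colon \mathcal{C}\to\mathcal{E}$ mapping denominators to isomorphisms is of the form $H = \hat H \circ \mathrm{loc}$ for a unique functor $\hat H\colon \mathsf{GZ}(\mathcal{C})\to\mathcal{E}$. For a morphism of categories with denominators $F\colon\mathcal{C} \to \mathcal{D}$, $\mathsf{GZ}(F)\colon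 \mathsf{GZ}(\mathcal{C}) \to \mathsf{GZ}(\mathcal{D})$ is the unique functor with $\mathrm{loc} \circ F = \mathsf{GZ}(F) \circ \mathrm{loc}$. $F$ is S-full (resp. S-faithful) if for all $X, X' \in \mathrm{Ob}\,\mathcal{C}$, every morphism $g\colon FX \to \tilde Y'$ in $\mathcal{D}$ and every denominator $b\colon FX' \to \tilde Y'$ in $\mathcal{D}$, there exists at least one (resp. at most one) morphism $\varphi\colon X \to X'$ in $\mathsf{GZ}(\mathcal{C})$ with $\mathrm{loc}(g)\,\mathrm{loc}(b)^{-1} = \mathsf{GZ}(F)\varphi$ in $\mathsf{GZ}(\mathcal{D})$. An S-replacement of $Y \in \mathrm{Ob}\,\mathcal{D}$ along $F$ is a pair $(X,q)$ consisting of an object $X$ in $\mathcal{C}$ and a denominator $q\colon FX \to Y$ in $\mathcal{D}$. A choice of S-replacements for $\mathcal{D}$ along $F$ is a family $R = ((X_Y,q_Y))_{Y\in\mathrm{Ob}\,\mathcal{D}}$ such that $(X_Y,q_Y)$ is an S-replacement of $Y$ along $F$ for every $Y$. The category of objects with S-replacement $\mathcal{D}_{\mathrm{Rpl}_{\mathrm{S}}(F)}$ has as objects the triples $(Y,X,q)$ with $Y \in \mathrm{Ob}\,\mathcal{D}$ and $(X,q)$ an S-replacement of $Y$ along $F$; morphisms $(Y,X,q)\to(Y',X',q')$ are the morphisms $Y \to Y'$ in $\mathcal{D}$ (hom-sets regarded as formally disjoint), with composition and identities as in $\mathcal{D}$; a morphism is a denominator iff its underlying morphism is a denominator in $\mathcal{D}$.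 For $F$ S-full and S-faithful, the total S-replacement functor $\bar{\mathrm{Q}}_{\mathrm{S}}F\colon \mathcal{D}_{\mathrm{Rpl}_{\mathrm{S}}(F)} \to \mathsf{GZ}(\mathcal{C})$ maps $(Y,X,q)$ to $X$ and maps a morphism $g\colon (Y,X,q)\to(Y',X',q')$ to the unique morphism $(\bar{\mathrm{Q}}_{\mathrm{S}}F)_{(X,q),(X',q')}g\colon X \to X'$ in $\mathsf{GZ}(\mathcal{C})$ with $\mathrm{loc}(q)\,\mathrm{loc}(g) = \bigl(\mathsf{GZ}(F)(\bar{\mathrm{Q}}_{\mathrm{S}}F)_{(X,q),(X',q')}g\bigr)\,\mathrm{loc}(q')$ in $\mathsf{GZ}(\mathcal{D})$. Given a choice of S-replacements $R$, the structure choice functor $\mathrm{I}_R\colon \mathcal{D}\to\mathcal{D}_{\mathrm{Rpl}_{\mathrm{S}}(F)}$ maps $Y$ to $(Y,X_Y,q_Y)$ and $g\colon Y\to Y'$ to $g\colon (Y,X_Y,q_Y)\to(Y',X_{Y'},q_{Y'})$. The S-replacement functor is $\mathrm{Q}_{\mathrm{S},R}F := \bar{\mathrm{Q}}_{\mathrm{S}}F \circ \mathrm{I}_R\colon \mathcal{D}\to\mathsf{GZ}(\mathcal{C})$. If $\mathcal{D}$ is multiplicative, it maps denominators to isomorphisms, and $\hat{\mathrm{Q}}_{\mathrm{S},R}F\colon \mathsf{GZ}(\mathcal{D})\to\mathsf{GZ}(\mathcal{C})$ denotes the unique functor with $\mathrm{Q}_{\mathrm{S},R}F = \hat{\mathrm{Q}}_{\mathrm{S},R}F\circ\mathrm{loc}$.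 *)

(* Defs.v *)
From Stdlib Require Import Classical ClassicalEpsilon FunctionalExtensionality
  PropExtensionality.

Set Implicit Arguments.
Unset Strict Implicit.
Unset Printing Implicit Defensive.

(* Composition is written in diagrammatic order: [f >>> g] is first f, then g. *)
Reserved Notation "f >>> g" (at level 40, left associativity).
(* Composition of functors is in the usual order: [G \o F] is first F, then G. *)
Reserved Notation "G \o F" (at level 50, left associativity).

Record Category : Type := {
  Ob :> Type;
  Hom : Ob -> Ob -> Type;
  idm : forall X : Ob, Hom X X;
  comp : forall X Y Z : Ob, Hom X Y -> Hom Y Z -> Hom X Z;
  comp_idl : forall (X Y : Ob) (f : Hom X Y), comp (idm X) f = f;
  comp_idr : forall (X Y : Ob) (f : Hom X Y), comp f (idm Y) = f;
  comp_assoc : forall (W X Y Z : Ob) (f : Hom W X) (g : Hom X Y) (h : Hom Y Z),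
    comp (comp f g) h = comp f (comp g h)
}.
Arguments Hom {c} X Y : rename.
Arguments idm {c} X : rename.
Arguments comp {c X Y Z} f g : rename.
Notation "f >>> g" := (comp f g).

Definition is_iso {C : Category} {X Y : C} (f : Hom X Y) : Prop :=
  exists g : Hom Y X, f >>> g = idm X /\ g >>> f = idm Y.

Definition iso_inv {C : Category} {X Y : C} (f : Hom X Y) (Hf : is_iso f) :
  Hom Y X := proj1_sig (constructive_indefinite_description _ Hf).

Lemma iso_inv_r {C : Category} {X Y : C} (f : Hom X Y) (Hf : is_iso f) :
  f >>> iso_inv Hf = idm X.
Proof.
  unfold iso_inv; destruct (constructive_indefinite_description _ Hf) as [g Hg].
  exact (proj1 Hg).
Qed.

Lemma iso_inv_l {C : Category} {X Y : C} (f : Hom X Y) (Hf : is_iso f) :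
  iso_inv Hf >>> f = idm Y.
Proof.
  unfold iso_inv; destruct (constructive_indefinite_description _ Hf) as [g Hg].
  exact (proj2 Hg).
Qed.

Lemma inverse_unique {C : Category} {X Y : C} (f : Hom X Y) (g h : Hom Y X) :
  g >>> f = idm Y -> f >>> h = idm X -> g = h.
Proof.
  intros Hg Hh.
  rewrite <- (comp_idr g), <- Hh, <- comp_assoc, Hg, comp_idl; reflexivity.
Qed.

Lemma comp_inv_move {C : Category} {X Y Z : C} (g : Hom X Y) (b : Hom Z Y)
  (c : Hom Y Z) (p : Hom X Z) : c >>> b = idm Y -> g >>> c = p -> g = p >>> b.
Proof. intros Hcb <-; rewrite comp_assoc, Hcb, comp_idr; reflexivity. Qed.

Lemma paste_squares {C : Category} {X Y Z X' Y' Z' : C}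
  (a : Hom X X') (b : Hom Y Y') (c : Hom Z Z')
  (p : Hom X Y) (q : Hom Y Z) (g : Hom X' Y') (h : Hom Y' Z') :
  a >>> g = p >>> b -> b >>> h = q >>> c -> a >>> (g >>> h) = (p >>> q) >>> c.
Proof.
  intros Hg Hh; rewrite <- comp_assoc, Hg, comp_assoc, Hh, comp_assoc.
  reflexivity.
Qed.

Lemma comp_inv_cancel {C : Category} {X Y Z : C} (a : Hom X Z) (b : Hom Y Z)
  (c : Hom Z X) (p : Hom X Y) (s : Hom Y X) :
  a >>> c = idm X -> a = p >>> b -> b >>> c = s -> p >>> s = idm X.
Proof. intros Hac Ha <-; rewrite <- comp_assoc, <- Ha; exact Hac. Qed.

Record Functor (C D : Category) : Type := {
  fob :> C -> D;
  fhom : forall X Y : C, Hom X Y -> Hom (fob X) (fob Y);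
  fhom_id : forall X : C, fhom (idm X) = idm (fob X);
  fhom_comp : forall (X Y Z : C) (f : Hom X Y) (g : Hom Y Z),
    fhom (f >>> g) = fhom f >>> fhom g
}.
Arguments fhom {C D} f {X Y} _ : rename.

Lemma functor_eq {C D : Category} (o : C -> D)
  (h h' : forall X Y : C, Hom X Y -> Hom (o X) (o Y)) i i' c c' :
  (forall (X Y : C) (f : Hom X Y), h X Y f = h' X Y f) ->
  {| fob := o; fhom := h; fhom_id := i; fhom_comp := c |} =
  {| fob := o; fhom := h'; fhom_id := i'; fhom_comp := c' |}.
Proof.
  intros E.
  assert (Eh : h = h').
  { apply functional_extensionality_dep; intros X.
    apply functional_extensionality_dep; intros Y.
    apply functional_extensionality; intros f; apply E. }
  subst h'.
  rewrite (proof_irrelevance _ i i'), (proof_irrelevance _ c c'); reflexivity.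
Qed.

Definition id_functor (C : Category) : Functor C C :=
  {| fob := fun X => X;
     fhom := fun _ _ f => f;
     fhom_id := fun _ => eq_refl;
     fhom_comp := fun _ _ _ _ _ => eq_refl |}.

Lemma comp_functor_id {C D E : Category} (G : Functor D E) (F : Functor C D)
  (X : C) : fhom G (fhom F (idm X)) = idm (G (F X)).
Proof. rewrite !fhom_id; reflexivity. Qed.

Lemma comp_functor_comp {C D E : Category} (G : Functor D E) (F : Functor C D)
  (X Y Z : C) (f : Hom X Y) (g : Hom Y Z) :
  fhom G (fhom F (f >>> g)) = fhom G (fhom F f) >>> fhom G (fhom F g).
Proof. rewrite !fhom_comp; reflexivity. Qed.

Definition comp_functor {C D E : Category} (G : Functor D E) (F : Functor C D) :
  Functor C E :=
  {| fob := fun X => G (F X);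
     fhom := fun X Y f => fhom G (fhom F f);
     fhom_id := comp_functor_id G F;
     fhom_comp := comp_functor_comp G F |}.
Notation "G \o F" := (comp_functor G F).

Definition is_transformation {C D : Category} (F G : Functor C D)
  (a : forall X : C, Hom (F X) (G X)) : Prop :=
  forall (X Y : C) (f : Hom X Y), fhom F f >>> a Y = a X >>> fhom G f.

Definition is_isotransformation {C D : Category} (F G : Functor C D)
  (a : forall X : C, Hom (F X) (G X)) : Prop :=
  is_transformation a /\ forall X : C, is_iso (a X).
Arguments is_isotransformation {C D} F G a.

Definition isomorphic {C D : Category} (F G : Functor C D) : Prop :=
  exists a : forall X : C, Hom (F X) (G X), is_isotransformation F G a.

Definition mutually_isomorphism_inverse {A B : Category}
  (H : Functor A B) (K : Functor B A) : Prop :=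
  isomorphic (K \o H) (id_functor A) /\ isomorphic (H \o K) (id_functor B).

Record DenCategory : Type := {
  den_cat :> Category;
  is_den : forall X Y : den_cat, Hom X Y -> Prop
}.
Arguments is_den {d X Y} f : rename.

Record DenFunctor (C D : DenCategory) : Type := {
  den_functor :> Functor C D;
  den_functor_den : forall (X Y : C) (d : Hom X Y),
    is_den d -> is_den (fhom den_functor d)
}.

Definition multiplicative (C : DenCategory) : Prop :=
  (forall X : C, is_den (idm X)) /\
  (forall (X Y Z : C) (d : Hom X Y) (e : Hom Y Z),
     is_den d -> is_den e -> is_den (d >>> e)).

(* GZ(C) is built by generators and relations: a morphism is a class of formal
   composites of morphisms of C and formal inverses of denominators, modulo the
   least congruence making this a category, [w_loc] a functor, and [w_inv d]
   inverse to [w_loc d]. *)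
Inductive GZword (C : DenCategory) : C -> C -> Type :=
| w_loc (X Y : C) (f : Hom X Y) : GZword X Y
| w_inv (X Y : C) (d : Hom X Y) (Hd : is_den d) : GZword Y X
| w_comp (X Y Z : C) (v : GZword X Y) (w : GZword Y Z) : GZword X Z.

Inductive GZrel (C : DenCategory) :
  forall X Y : C, GZword X Y -> GZword X Y -> Prop :=
| r_refl (X Y : C) (w : GZword X Y) : GZrel w w
| r_sym (X Y : C) (v w : GZword X Y) : GZrel v w -> GZrel w v
| r_trans (X Y : C) (u v w : GZword X Y) : GZrel u v -> GZrel v w -> GZrel u w
| r_comp (X Y Z : C) (v v' : GZword X Y) (w w' : GZword Y Z) :
    GZrel v v' -> GZrel w w' -> GZrel (w_comp v w) (w_comp v' w')
| r_idl (X Y : C) (w : GZword X Y) : GZrel (w_comp (w_loc (idm X)) w) w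
| r_idr (X Y : C) (w : GZword X Y) : GZrel (w_comp w (w_loc (idm Y))) w
| r_assoc (W X Y Z : C) (u : GZword W X) (v : GZword X Y) (w : GZword Y Z) :
    GZrel (w_comp (w_comp u v) w) (w_comp u (w_comp v w))
| r_loc (X Y Z : C) (f : Hom X Y) (g : Hom Y Z) :
    GZrel (w_loc (f >>> g)) (w_comp (w_loc f) (w_loc g))
| r_invr (X Y : C) (d : Hom X Y) (Hd : is_den d) :
    GZrel (w_comp (w_loc d) (w_inv Hd)) (w_loc (idm X))
| r_invl (X Y : C) (d : Hom X Y) (Hd : is_den d) :
    GZrel (w_comp (w_inv Hd) (w_loc d)) (w_loc (idm Y)).

Definition GZhom (C : DenCategory) (X Y : C) : Type :=
  {P : GZword X Y -> Prop | exists w, P = GZrel w}.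

Definition cls {C : DenCategory} {X Y : C} (w : GZword X Y) : GZhom X Y :=
  exist _ (GZrel w) (ex_intro _ w eq_refl).

Lemma cls_eq {C : DenCategory} {X Y : C} (v w : GZword X Y) :
  GZrel v w -> cls v = cls w.
Proof.
  intros E; unfold cls.
  assert (H : GZrel v = GZrel w).
  { apply functional_extensionality; intros u.
    apply propositional_extensionality; split; intros Hu.
    - exact (r_trans (r_sym E) Hu).
    - exact (r_trans E Hu). }
  apply eq_sig_hprop; [intros ? ? ?; apply proof_irrelevance | exact H].
Qed.

Lemma cls_inj {C : DenCategory} {X Y : C} (v w : GZword X Y) :
  cls v = cls w -> GZrel v w.
Proof.
  intros E; apply (f_equal (@proj1_sig _ _)) in E; simpl in E.
  rewrite E; apply r_refl.
Qed.

Lemma cls_surj {C : DenCategory} {X Y : C} (p : GZhom X Y) :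
  exists w, cls w = p.
Proof.
  destruct p as [P [w Hw]]; exists w; subst P; reflexivity.
Qed.

Definition repr {C : DenCategory} {X Y : C} (p : GZhom X Y) : GZword X Y :=
  proj1_sig (constructive_indefinite_description _ (cls_surj p)).

Lemma cls_repr {C : DenCategory} {X Y : C} (p : GZhom X Y) : cls (repr p) = p.
Proof.
  exact (proj2_sig (constructive_indefinite_description _ (cls_surj p))).
Qed.

Lemma repr_cls {C : DenCategory} {X Y : C} (w : GZword X Y) :
  GZrel (repr (cls w)) w.
Proof. apply cls_inj, cls_repr. Qed.

Definition GZcomp {C : DenCategory} {X Y Z : C}
  (p : GZhom X Y) (q : GZhom Y Z) : GZhom X Z :=
  cls (w_comp (repr p) (repr q)).

Lemma GZcomp_cls {C : DenCategory} {X Y Z : C}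
  (v : GZword X Y) (w : GZword Y Z) :
  GZcomp (cls v) (cls w) = cls (w_comp v w).
Proof. apply cls_eq, r_comp; apply repr_cls. Qed.

Lemma GZ_idl (C : DenCategory) (X Y : C) (p : GZhom X Y) :
  GZcomp (cls (w_loc (idm X))) p = p.
Proof.
  destruct (cls_surj p) as [w <-]; rewrite GZcomp_cls; apply cls_eq, r_idl.
Qed.

Lemma GZ_idr (C : DenCategory) (X Y : C) (p : GZhom X Y) :
  GZcomp p (cls (w_loc (idm Y))) = p.
Proof.
  destruct (cls_surj p) as [w <-]; rewrite GZcomp_cls; apply cls_eq, r_idr.
Qed.

Lemma GZ_assoc (C : DenCategory) (W X Y Z : C)
  (p : GZhom W X) (q : GZhom X Y) (r : GZhom Y Z) :
  GZcomp (GZcomp p q) r = GZcomp p (GZcomp q r).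
Proof.
  destruct (cls_surj p) as [u <-], (cls_surj q) as [v <-], (cls_surj r) as [w <-].
  rewrite !GZcomp_cls; apply cls_eq, r_assoc.
Qed.

Definition GZ (C : DenCategory) : Category :=
  {| Ob := Ob C;
     Hom := @GZhom C;
     idm := fun X => cls (w_loc (idm X));
     comp := fun X Y Z p q => GZcomp p q;
     comp_idl := @GZ_idl C;
     comp_idr := @GZ_idr C;
     comp_assoc := @GZ_assoc C |}.

Lemma loc_comp (C : DenCategory) (X Y Z : C) (f : Hom X Y) (g : Hom Y Z) :
  cls (w_loc (f >>> g)) = GZcomp (cls (w_loc f)) (cls (w_loc g)).
Proof. rewrite GZcomp_cls; apply cls_eq, r_loc. Qed.

Definition loc (C : DenCategory) : Functor C (GZ C) :=
  {| fob := fun X : C => X : GZ C;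
     fhom := fun X Y f => cls (w_loc f) : @Hom (GZ C) X Y;
     fhom_id := fun X => eq_refl;
     fhom_comp := @loc_comp C |}.

Definition loc_inv {C : DenCategory} {X Y : C} (d : Hom X Y) (Hd : is_den d) :
  Hom (loc C Y) (loc C X) := cls (w_inv Hd).

Lemma loc_inv_r {C : DenCategory} {X Y : C} (d : Hom X Y) (Hd : is_den d) :
  fhom (loc C) d >>> loc_inv Hd = idm (loc C X).
Proof. simpl; unfold loc_inv; rewrite GZcomp_cls; apply cls_eq, r_invr. Qed.

Lemma loc_inv_l {C : DenCategory} {X Y : C} (d : Hom X Y) (Hd : is_den d) :
  loc_inv Hd >>> fhom (loc C) d = idm (loc C Y).
Proof. simpl; unfold loc_inv; rewrite GZcomp_cls; apply cls_eq, r_invl. Qed.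

Definition inverts_den {C : DenCategory} {E : Category} (H : Functor C E) : Prop :=
  forall (X Y : C) (d : Hom X Y), is_den d -> is_iso (fhom H d).

Lemma loc_inverts_den (C : DenCategory) : inverts_den (loc C).
Proof.
  intros X Y d Hd; exists (loc_inv Hd); split;
    [apply loc_inv_r | apply loc_inv_l].
Qed.

Fixpoint eval {C : DenCategory} {E : Category} {H : Functor C E}
  (HH : inverts_den H) {X Y : C} (w : GZword X Y) : Hom (H X) (H Y) :=
  match w in GZword X Y return Hom (H X) (H Y) with
  | w_loc f => fhom H f
  | w_inv Hd => iso_inv (HH _ _ _ Hd)
  | w_comp v w => eval HH v >>> eval HH w
  end.

Lemma eval_rel {C : DenCategory} {E : Category} {H : Functor C E}
  (HH : inverts_den H) (X Y : C) (v w : GZword X Y) :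
  GZrel v w -> eval HH v = eval HH w.
Proof.
  intros R; induction R; simpl.
  - reflexivity.
  - symmetry; assumption.
  - etransitivity; eassumption.
  - rewrite IHR1, IHR2; reflexivity.
  - rewrite fhom_id; apply comp_idl.
  - rewrite fhom_id; apply comp_idr.
  - apply comp_assoc.
  - apply fhom_comp.
  - rewrite fhom_id; apply iso_inv_r.
  - rewrite fhom_id; apply iso_inv_l.
Qed.

Lemma GZ_lift_id {C : DenCategory} {E : Category} {H : Functor C E}
  (HH : inverts_den H) (X : GZ C) : eval HH (repr (idm X)) = idm (H X).
Proof.
  simpl; rewrite (eval_rel HH (repr_cls _)); apply fhom_id.
Qed.

Lemma GZ_lift_comp {C : DenCategory} {E : Category} {H : Functor C E}
  (HH : inverts_den H) (X Y Z : GZ C) (p : Hom X Y) (q : Hom Y Z) :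
  eval HH (repr (p >>> q)) = eval HH (repr p) >>> eval HH (repr q).
Proof. exact (eval_rel HH (repr_cls _)). Qed.

Definition GZ_lift {C : DenCategory} {E : Category} (H : Functor C E)
  (HH : inverts_den H) : Functor (GZ C) E :=
  {| fob := fun X : GZ C => H X;
     fhom := fun (X Y : GZ C) (p : Hom X Y) => eval HH (repr p);
     fhom_id := GZ_lift_id HH;
     fhom_comp := GZ_lift_comp HH |}.

Lemma GZ_lift_locE {C : DenCategory} {E : Category} (H : Functor C E)
  (HH : inverts_den H) (X Y : C) (f : Hom X Y) :
  fhom (GZ_lift HH) (fhom (loc C) f) = fhom H f.
Proof. exact (eval_rel HH (repr_cls _)). Qed.

Lemma GZ_lift_loc {C : DenCategory} {E : Category} (H : Functor C E)
  (HH : inverts_den H) : H = GZ_lift HH \o loc C.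
Proof.
  generalize (GZ_lift_locE HH); destruct H as [o h i c]; intros E1.
  apply functor_eq; intros X Y f; symmetry; apply E1.
Qed.

Lemma GZ_hom_ind {C : DenCategory}
  (P : forall X Y : C, @Hom (GZ C) X Y -> Prop) :
  (forall (X Y : C) (f : Hom X Y), P X Y (fhom (loc C) f)) ->
  (forall (X Y : C) (d : Hom X Y) (Hd : is_den d), P Y X (loc_inv Hd)) ->
  (forall (X Y Z : C) (p : @Hom (GZ C) X Y) (q : @Hom (GZ C) Y Z),
     P X Y p -> P Y Z q -> P X Z (p >>> q)) ->
  forall (X Y : C) (p : @Hom (GZ C) X Y), P X Y p.
Proof.
  intros Hl Hi Hc X Y p; destruct (cls_surj p) as [w <-].
  induction w as [X Y f | X Y d Hd | X Y Z v IHv w IHw].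
  - apply Hl.
  - apply Hi.
  - rewrite <- GZcomp_cls; apply (Hc _ _ _ _ _ IHv IHw).
Qed.

Lemma GZ_lift_unique {C : DenCategory} {E : Category} (H : Functor C E)
  (HH : inverts_den H) (K : Functor (GZ C) E) :
  H = K \o loc C -> K = GZ_lift HH.
Proof.
  intros EK; subst H; destruct K as [o h i c].
  apply functor_eq; intros X Y p.
  set (K := {| fob := o; fhom := h; fhom_id := i; fhom_comp := c |}) in *.
  change (fhom K p = fhom (GZ_lift HH) p); clearbody K; clear h i c.
  revert X Y p.
  apply (GZ_hom_ind (P := fun X Y p => fhom K p = fhom (GZ_lift HH) p)).
  - intros X Y f; symmetry; apply (GZ_lift_locE HH).
  - intros X Y d Hd; apply (inverse_unique (f := fhom K (fhom (loc C) d))).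
    + exact (eq_trans (eq_sym (fhom_comp K _ _))
        (eq_trans (f_equal (fhom K) (loc_inv_l Hd)) (fhom_id K _))).
    + assert (EK : fhom K (fhom (loc C) d) = fhom (GZ_lift HH) (fhom (loc C) d))
        by (symmetry; apply (GZ_lift_locE HH)).
      rewrite EK.
      exact (eq_trans (eq_sym (fhom_comp (GZ_lift HH) _ _))
        (eq_trans (f_equal (fhom (GZ_lift HH)) (loc_inv_r Hd))
          (fhom_id (GZ_lift HH) _))).
  - intros X Y Z p q Hp Hq; rewrite !fhom_comp, Hp, Hq; reflexivity.
Qed.

Lemma GZ_map_inverts {C D : DenCategory} (F : DenFunctor C D) :
  inverts_den (loc D \o F).
Proof. intros X Y d Hd; apply loc_inverts_den, den_functor_den, Hd. Qed.

Definition GZ_map {C D : DenCategory} (F : DenFunctor C D) :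
  Functor (GZ C) (GZ D) := GZ_lift (GZ_map_inverts F).

Lemma GZ_map_loc {C D : DenCategory} (F : DenFunctor C D) :
  loc D \o F = GZ_map F \o loc C.
Proof. apply GZ_lift_loc. Qed.

Definition S_full {C D : DenCategory} (F : DenFunctor C D) : Prop :=
  forall (X X' : C) (Y' : D) (g : Hom (F X) Y') (b : Hom (F X') Y')
    (Hb : is_den b),
  exists p : @Hom (GZ C) X X',
    fhom (loc D) g >>> loc_inv Hb = fhom (GZ_map F) p.

Definition S_faithful {C D : DenCategory} (F : DenFunctor C D) : Prop :=
  forall (X X' : C) (Y' : D) (g : Hom (F X) Y') (b : Hom (F X') Y')
    (Hb : is_den b) (p p' : @Hom (GZ C) X X'),
    fhom (loc D) g >>> loc_inv Hb = fhom (GZ_map F) p ->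
    fhom (loc D) g >>> loc_inv Hb = fhom (GZ_map F) p' ->
    p = p'.

Record S_replacement {C D : DenCategory} (F : DenFunctor C D) (Y : D) : Type := {
  rpl_ob : C;
  rpl_map : Hom (F rpl_ob) Y;
  rpl_den : is_den rpl_map
}.

Definition S_replacement_choice {C D : DenCategory} (F : DenFunctor C D) : Type :=
  forall Y : D, S_replacement F Y.

Definition trivial_replacement {C D : DenCategory} (F : DenFunctor C D)
  (HD : multiplicative D) (X : C) : S_replacement F (F X) :=
  {| rpl_ob := X; rpl_map := idm (F X); rpl_den := proj1 HD (F X) |}.

Record RplOb {C D : DenCategory} (F : DenFunctor C D) : Type := {
  rpl_base : D;
  rpl_str : S_replacement F rpl_base
}.

Definition RplCategory {C D : DenCategory} (F : DenFunctor C D) : Category :=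
  {| Ob := RplOb F;
     Hom := fun A B => Hom (rpl_base A) (rpl_base B);
     idm := fun A => idm (rpl_base A);
     comp := fun _ _ _ f g => f >>> g;
     comp_idl := fun _ _ f => comp_idl f;
     comp_idr := fun _ _ f => comp_idr f;
     comp_assoc := fun _ _ _ _ f g h => comp_assoc f g h |}.

Definition Rpl {C D : DenCategory} (F : DenFunctor C D) : DenCategory :=
  {| den_cat := RplCategory F;
     is_den := fun A B (g : @Hom (RplCategory F) A B) =>
       @is_den D (rpl_base A) (rpl_base B) g |}.

Lemma Qbar_exists {C D : DenCategory} (F : DenFunctor C D)
  (Hfull : S_full F) (Hfaith : S_faithful F) (Y Y' : D)
  (r : S_replacement F Y) (r' : S_replacement F Y') (g : Hom Y Y') :
  exists! p : @Hom (GZ C) (rpl_ob r) (rpl_ob r'),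
    fhom (loc D) (rpl_map r) >>> fhom (loc D) g =
    fhom (GZ_map F) p >>> fhom (loc D) (rpl_map r').
Proof.
  destruct (Hfull _ _ _ (rpl_map r >>> g) _ (rpl_den r')) as [p Hp].
  exists p; split.
  - rewrite <- fhom_comp; exact (comp_inv_move (loc_inv_l (rpl_den r')) Hp).
  - intros p' Hp'; apply (Hfaith _ _ _ _ _ _ _ _ Hp).
    rewrite <- fhom_comp in Hp'.
    exact (eq_sym (comp_inv_move (loc_inv_r (rpl_den r')) (eq_sym Hp'))).
Qed.

Definition Qbar_hom {C D : DenCategory} {F : DenFunctor C D}
  (Hfull : S_full F) (Hfaith : S_faithful F) {Y Y' : D}
  (r : S_replacement F Y) (r' : S_replacement F Y') (g : Hom Y Y') :
  @Hom (GZ C) (rpl_ob r) (rpl_ob r') :=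
  proj1_sig (constructive_indefinite_description _
    (Qbar_exists Hfull Hfaith r r' g)).

Lemma Qbar_homE {C D : DenCategory} {F : DenFunctor C D}
  (Hfull : S_full F) (Hfaith : S_faithful F) {Y Y' : D}
  (r : S_replacement F Y) (r' : S_replacement F Y') (g : Hom Y Y') :
  fhom (loc D) (rpl_map r) >>> fhom (loc D) g =
  fhom (GZ_map F) (Qbar_hom Hfull Hfaith r r' g) >>> fhom (loc D) (rpl_map r').
Proof.
  unfold Qbar_hom; destruct (constructive_indefinite_description _ _) as [p Hp].
  exact (proj1 Hp).
Qed.

Lemma Qbar_hom_unique {C D : DenCategory} {F : DenFunctor C D}
  (Hfull : S_full F) (Hfaith : S_faithful F) {Y Y' : D}
  (r : S_replacement F Y) (r' : S_replacement F Y') (g : Hom Y Y')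
  (p : @Hom (GZ C) (rpl_ob r) (rpl_ob r')) :
  fhom (loc D) (rpl_map r) >>> fhom (loc D) g =
    fhom (GZ_map F) p >>> fhom (loc D) (rpl_map r') ->
  Qbar_hom Hfull Hfaith r r' g = p.
Proof.
  unfold Qbar_hom; destruct (constructive_indefinite_description _ _) as [p' Hp'].
  exact (proj2 Hp' p).
Qed.

Lemma Qbar_id {C D : DenCategory} {F : DenFunctor C D}
  (Hfull : S_full F) (Hfaith : S_faithful F) (A : Rpl F) :
  Qbar_hom Hfull Hfaith (rpl_str A) (rpl_str A) (idm (rpl_base A)) =
  idm (rpl_ob (rpl_str A) : GZ C).
Proof.
  apply Qbar_hom_unique; rewrite !fhom_id, comp_idr; symmetry; apply comp_idl.
Qed.

Lemma Qbar_comp {C D : DenCategory} {F : DenFunctor C D}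
  (Hfull : S_full F) (Hfaith : S_faithful F) (A A' A'' : Rpl F)
  (g : @Hom (Rpl F) A A') (g' : @Hom (Rpl F) A' A'') :
  Qbar_hom Hfull Hfaith (rpl_str A) (rpl_str A'') (g >>> g') =
  Qbar_hom Hfull Hfaith (rpl_str A) (rpl_str A') g >>>
  Qbar_hom Hfull Hfaith (rpl_str A') (rpl_str A'') g'.
Proof.
  apply Qbar_hom_unique; rewrite (fhom_comp (GZ_map F)).
  refine (eq_trans (f_equal (comp _) (fhom_comp (loc D) g g')) _).
  exact (paste_squares (Qbar_homE Hfull Hfaith _ _ _)
    (Qbar_homE Hfull Hfaith _ _ _)).
Qed.

Definition Qbar {C D : DenCategory} {F : DenFunctor C D}
  (Hfull : S_full F) (Hfaith : S_faithful F) : Functor (Rpl F) (GZ C) :=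
  {| fob := fun A : Rpl F => rpl_ob (rpl_str A) : GZ C;
     fhom := fun (A B : Rpl F) (g : Hom A B) =>
       Qbar_hom Hfull Hfaith (rpl_str A) (rpl_str B) g;
     fhom_id := Qbar_id Hfull Hfaith;
     fhom_comp := Qbar_comp Hfull Hfaith |}.

Definition structure_choice {C D : DenCategory} {F : DenFunctor C D}
  (R : S_replacement_choice F) : Functor D (Rpl F) :=
  {| fob := fun Y : D => {| rpl_base := Y; rpl_str := R Y |} : Rpl F;
     fhom := fun (Y Y' : D) (g : Hom Y Y') => g;
     fhom_id := fun _ => eq_refl;
     fhom_comp := fun _ _ _ _ _ => eq_refl |}.

Definition Q {C D : DenCategory} {F : DenFunctor C D}
  (Hfull : S_full F) (Hfaith : S_faithful F) (R : S_replacement_choice F) :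
  Functor D (GZ C) := Qbar Hfull Hfaith \o structure_choice R.

Lemma GZ_map_inj {C D : DenCategory} {F : DenFunctor C D}
  (Hfull : S_full F) (Hfaith : S_faithful F) {Y Y' : D}
  (r : S_replacement F Y) (r' : S_replacement F Y') (g : Hom Y Y')
  (p p' : @Hom (GZ C) (rpl_ob r) (rpl_ob r')) :
  fhom (loc D) (rpl_map r) >>> fhom (loc D) g =
    fhom (GZ_map F) p >>> fhom (loc D) (rpl_map r') ->
  fhom (GZ_map F) p = fhom (GZ_map F) p' -> p = p'.
Proof.
  intros H E.
  rewrite <- (Qbar_hom_unique Hfull Hfaith H).
  apply (Qbar_hom_unique Hfull Hfaith); rewrite <- E; exact H.
Qed.

Lemma Q_inverts_den {C D : DenCategory} {F : DenFunctor C D}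
  (HD : multiplicative D) (Hfull : S_full F) (Hfaith : S_faithful F)
  (R : S_replacement_choice F) : inverts_den (Q Hfull Hfaith R).
Proof.
  intros Y Y' d Hd.
  change (is_iso (Qbar_hom Hfull Hfaith (R Y) (R Y') d)).
  set (p := Qbar_hom Hfull Hfaith (R Y) (R Y') d).
  assert (Hp := Qbar_homE Hfull Hfaith (R Y) (R Y') d); fold p in Hp.
  assert (Hqd := proj2 HD _ _ _ _ _ (rpl_den (R Y)) Hd).
  destruct (Hfull _ _ _ (rpl_map (R Y')) _ Hqd) as [s Hs].
  rewrite <- fhom_comp in Hp.
  assert (Hp' := comp_inv_move (loc_inv_r (rpl_den (R Y'))) (eq_sym Hp)).
  assert (Hs' := comp_inv_move (loc_inv_l Hqd) Hs).
  assert (E1 : fhom (GZ_map F) (p >>> s) = fhom (GZ_map F) (idm _)).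
  { rewrite fhom_comp, fhom_id.
    exact (comp_inv_cancel (loc_inv_r Hqd) Hp Hs). }
  assert (E2 : fhom (GZ_map F) (s >>> p) = fhom (GZ_map F) (idm _)).
  { rewrite fhom_comp, fhom_id.
    exact (comp_inv_cancel (loc_inv_r (rpl_den (R Y'))) Hs' (eq_sym Hp')). }
  exists s; split.
  - symmetry; apply (GZ_map_inj Hfull Hfaith (r := R Y) (r' := R Y) (g := idm Y));
      [| symmetry; exact E1].
    rewrite !fhom_id, comp_idr; symmetry; apply comp_idl.
  - symmetry; apply (GZ_map_inj Hfull Hfaith (r := R Y') (r' := R Y') (g := idm Y'));
      [| symmetry; exact E2].
    rewrite !fhom_id, comp_idr; symmetry; apply comp_idl.
Qed.

Definition Qhat {C D : DenCategory} {F : DenFunctor C D}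
  (HD : multiplicative D) (Hfull : S_full F) (Hfaith : S_faithful F)
  (R : S_replacement_choice F) : Functor (GZ D) (GZ C) :=
  GZ_lift (Q_inverts_den HD Hfull Hfaith R).

(* Main.v *)
(* On the GZ-side both naturality claims need only be checked on morphisms
   [loc f], since a transformation compatible with an isomorphism is compatible
   with its inverse.  There, the one for beta is the defining equation of Qbar,
   and the one for alpha follows from the functoriality of Qbar, because [loc f]
   is the value of Qbar at [F f] with respect to trivial S-replacements. *)
Require Import Defs.

(** Insert [l >>> l'] after [a], replace [a >>> l] by [k >>> b] and cancel [k' >>> k]. *)
Lemma square_inverse (E : Category) (X Y X' Y' : E) (k : Hom X Y)
  (k' : Hom Y X) (l : Hom X' Y') (l' : Hom Y' X') (a : Hom X X')
  (b : Hom Y Y') :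
  k' >>> k = idm Y -> l >>> l' = idm X' -> k >>> b = a >>> l ->
  k' >>> a = b >>> l'.
Proof.
  intros Hk Hl H.
  rewrite <- (comp_idr a), <- Hl, <- (comp_assoc a), <- H, <- !comp_assoc, Hk.
  rewrite comp_idl; reflexivity.
Qed.

Lemma GZ_transformation (C : DenCategory) (E : Category)
  (K L : Functor (GZ C) E) (a : forall X : GZ C, Hom (K X) (L X)) :
  (forall (X Y : C) (f : Hom X Y),
     fhom K (fhom (loc C) f) >>> a Y = a X >>> fhom L (fhom (loc C) f)) ->
  is_transformation a.
Proof.
  intros Hloc.
  refine (GZ_hom_ind (P := fun X Y p => fhom K p >>> a Y = a X >>> fhom L p)
    _ _ _).
  - exact Hloc.
  - intros X Y d Hd.
    (* Functors preserve inverses, so the naturality square at [d] can be reversed to give the one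
       at [loc_inv Hd]. *)
    assert (EK : fhom K (loc_inv Hd) >>> fhom K (fhom (loc C) d) = idm (K Y))
      by exact (eq_trans (eq_sym (fhom_comp K _ _))
        (eq_trans (f_equal (fhom K) (loc_inv_l Hd)) (fhom_id K _))).
    assert (EL : fhom L (fhom (loc C) d) >>> fhom L (loc_inv Hd) = idm (L X))
      by exact (eq_trans (eq_sym (fhom_comp L _ _))
        (eq_trans (f_equal (fhom L) (loc_inv_r Hd)) (fhom_id L _))).
    exact (square_inverse E _ _ _ _ _ _ _ _ _ _ EK EL (Hloc X Y d)).
  - intros X Y Z p q Hp Hq.
    rewrite !fhom_comp, comp_assoc, Hq, <- comp_assoc, Hp, comp_assoc.
    reflexivity.
Qed.

Section SReplacement.

Variables (C D : DenCategory) (F : DenFunctor C D).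
Hypotheses (HD : multiplicative D) (Hfull : S_full F) (Hfaith : S_faithful F).

(** For identities as replacement maps, the equation characterising [Qbar_hom] reduces to the
    compatibility of [GZ_map F] with localisation. *)
Lemma Qbar_hom_trivial (X X' : C) (f : Hom X X') :
  Qbar_hom Hfull Hfaith (trivial_replacement F HD X)
    (trivial_replacement F HD X') (fhom F f) = fhom (loc C) f.
Proof.
  apply Qbar_hom_unique.
  refine (eq_trans (comp_idl _) (eq_trans _ (eq_sym (comp_idr _)))).
  symmetry; exact (GZ_lift_locE (GZ_map_inverts F) f).
Qed.

Lemma Qbar_hom_comp {Y Y' Y'' : D} (r : S_replacement F Y)
  (r' : S_replacement F Y') (r'' : S_replacement F Y'')
  (g : Hom Y Y') (g' : Hom Y' Y'') :
  Qbar_hom Hfull Hfaith r r' g >>> Qbar_hom Hfull Hfaith r' r'' g' =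
  Qbar_hom Hfull Hfaith r r'' (g >>> g').
Proof.
  symmetry.
  exact (Qbar_comp Hfull Hfaith (A := {| rpl_str := r |})
    (A' := {| rpl_str := r' |}) (A'' := {| rpl_str := r'' |}) g g').
Qed.

(** Morphisms of [Rpl F] ignore the replacements, so [idm Y] is an isomorphism between [Y] with [r]
    and [Y] with [r']; the functor [Qbar] preserves it. *)
Lemma Qbar_hom_idm_inverse {Y : D} (r r' : S_replacement F Y) :
  Qbar_hom Hfull Hfaith r r' (idm Y) >>> Qbar_hom Hfull Hfaith r' r (idm Y) =
  idm (rpl_ob r : GZ C).
Proof.
  rewrite Qbar_hom_comp, comp_idl.
  exact (Qbar_id Hfull Hfaith {| rpl_str := r |}).
Qed.

Variable R : S_replacement_choice F.

Lemma Qhat_loc (Y Y' : D) (g : Hom Y Y') :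
  fhom (Qhat HD Hfull Hfaith R) (fhom (loc D) g) =
  Qbar_hom Hfull Hfaith (R Y) (R Y') g.
Proof. exact (GZ_lift_locE (Q_inverts_den HD Hfull Hfaith R) g). Qed.

Lemma Qhat_GZ_map_isotransformation :
  is_isotransformation (Qhat HD Hfull Hfaith R \o GZ_map F) (id_functor (GZ C))
    (fun X' : C =>
       Qbar_hom Hfull Hfaith (R (F X')) (trivial_replacement F HD X')
         (idm (F X'))).
Proof.
  split.
  - apply GZ_transformation; intros X X' f.
    (* Both sides turn out to be [Qbar_hom] at [fhom F f], from [R (F X)] to the trivial replacement
       of [F X']. *)
    refine (eq_trans (f_equal (fun p => fhom (Qhat HD Hfull Hfaith R) p >>> _)
      (GZ_lift_locE (GZ_map_inverts F) f)) _).
    refine (eq_trans (f_equal (fun p => p >>> _) (Qhat_loc _ _ (fhom F f))) _).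
    refine (eq_trans _ (f_equal (comp _) (Qbar_hom_trivial _ _ f))).
    refine (eq_trans (Qbar_hom_comp _ _ _ _ _) _).
    refine (eq_trans _ (eq_sym (Qbar_hom_comp _ _ _ _ _))).
    rewrite comp_idl, comp_idr; reflexivity.
  - intros X.
    (* The inverse arises by exchanging the two replacements of [F X]. *)
    exists (Qbar_hom Hfull Hfaith (trivial_replacement F HD X) (R (F X))
      (idm (F X))).
    split; [exact (Qbar_hom_idm_inverse (R (F X)) (trivial_replacement F HD X))
      | exact (Qbar_hom_idm_inverse (trivial_replacement F HD X) (R (F X)))].
Qed.

Lemma GZ_map_Qhat_isotransformation :
  is_isotransformation (GZ_map F \o Qhat HD Hfull Hfaith R) (id_functor (GZ D))
    (fun Y : D => fhom (loc D) (rpl_map (R Y))).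
Proof.
  split.
  - apply GZ_transformation; intros Y Y' g.
    refine (eq_trans (f_equal (fun p => fhom (GZ_map F) p >>> _)
      (Qhat_loc _ _ g)) _).
    symmetry; apply Qbar_homE.
  (* The map of a replacement is a denominator, hence inverted by [loc D]. *)
  - intros Y; apply loc_inverts_den, rpl_den.
Qed.

End SReplacement.

Theorem theorem5p24 (C D : DenCategory) (F : DenFunctor C D)
  (HD : multiplicative D) (Hfull : S_full F) (Hfaith : S_faithful F)
  (R : S_replacement_choice F) :
  mutually_isomorphism_inverse (GZ_map F) (Qhat HD Hfull Hfaith R) /\
  is_isotransformation (Qhat HD Hfull Hfaith R \o GZ_map F) (id_functor (GZ C))
    (fun X' : C =>
       Qbar_hom Hfull Hfaith (R (F X')) (trivial_replacement F HD X')
         (idm (F X'))) /\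
  is_isotransformation (GZ_map F \o Qhat HD Hfull Hfaith R) (id_functor (GZ D))
    (fun Y : D => fhom (loc D) (rpl_map (R Y))).
Proof.
  pose proof (Qhat_GZ_map_isotransformation C D F HD Hfull Hfaith R) as Ha.
  pose proof (GZ_map_Qhat_isotransformation C D F HD Hfull Hfaith R) as Hb.
  split; [split; eexists; [exact Ha | exact Hb] | split; [exact Ha | exact Hb]].
Qed.
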